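(* Let $(A,\triangleright_A,\triangleleft_A)$ and $(A^*,\triangleright_{A^*},\triangleleft_{A^*})$ be special apre-perm algebras, with associated perm algebras $(A,\circ_A)$ and $(A^*,\circ_{A^*})$. Then the following conditions are equivalent. (a) There is a Manin triple $\big((A\oplus A^*,\circ_d,\mathcal B_d),(A,\circ_A),(A^*,\circ_{A^*})\big)$ of perm algebras associated to the nondegenerate symmetric left-invariant bilinear form $\mathcal B_d$ such that the compatible special apre-perm algebra $(A\oplus A^*,\triangleright_d,\triangleleft_d)$ induced from $\mathcal B_d$ contains $(A,\triangleright_A,\triangleleft_A)$ and $(A^*,\triangleright_{A^*},\triangleleft_{A^*})$ as subalgebras. (b) There is a Manin triple $\big((A\oplus A^*,\triangleright_d,\triangleleft_d,\mathcal B_d),(A,\triangleright_A,\triangleleft_A),(A^*,\triangleright_{A^*},\triangleleft_{A^*})\big)$ of special apre-perm algebras. (c) There is a special apre-perm algebra $(A\oplus A^*,\triangleright_d,\triangleleft_d)$ with $\triangleright_d,\triangleleft_d$ defined, for all $x,y\in A$, $a^*,b^*\in A^*$, by $$(x+a^* )\triangleright_d(y+b^* )=x\triangleright_A y+(\mathcal L^*_{\circ_{A^*}}+\mathcal R^*_{\circ_{A^*}})(a^* )y+\mathcal R^*_{\triangleright_{A^*}}(b^* )x+a^*\triangleright_{A^*}b^*+(\mathcal L^*_{\circ_A}+\mathcal R^*_{\circ_A})(x)b^*+\mathcal R^*_{\triangleright_A}(y)a^*,$$ $$(x+a^* )\triangleleft_d(y+b^* )=x\triangleleft_A y-\mathcal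 R^*_{\circ_{A^*}}(a^* )y-\mathcal R^*_{\circ_{A^*}}(b^* )x+a^*\triangleleft_{A^*}b^*-\mathcal R^*_{\circ_A}(x)b^*-\mathcal R^*_{\circ_A}(y)a^*.$$ (d) $(A,\triangleright_A,\triangleleft_A,\vartheta,\theta)$ is a special apre-perm bialgebra, where $\vartheta,\theta:A\to A\otimes A$ are the linear duals of $\triangleright_{A^*}$ and $\triangleleft_{A^*}$ respectively.
   Context: All vector spaces and algebras are finite-dimensional over an algebraically closed field $\mathbb K$ of characteristic zero. For a bilinear operation $\circ$ on $A$: $\mathcal L_\circ(x)y=x\circ y$, $\mathcal R_\circ(x)y=y\circ x$. For linear $\mu:A\to\mathrm{End}_{\mathbb K}(V)$, $\mu^*:A\to\mathrm{End}_{\mathbb K}(V^* )$ is $\langle\mu^*(x)u^*,v\rangle=\langle u^*,\mu(x)v\rangle$; $A^{**}$ is identified with $A$. $\tau$ is the flip on $A\otimes A$. $\mathcal B_d(x+a^*,y+b^* )=\langle x,b^*\rangle+\langle a^*,y\rangle$ on $A\oplus A^*$. A perm algebra $(A,\circ_A)$ satisfies $x\circ_A(y\circ_A z)=(x\circ_A y)\circ_A z=(y\circ_A x)\circ_A z$. A bilinear form is left-invariant if $\mathcal B(x\circ_A y,z)=\mathcal B(y,x\circ_A z)$. An apre-perm algebra is a vector space $A$ with multiplications $\triangleright_A,\triangleleft_A$ such that, setting $x\circ_A y=x\triangleright_A y+x\triangleleft_A y$ and $x\bullet_A y=x\triangleright_A y+y\triangleleft_A x$, $(A,\circ_A)$ is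 a perm algebra (the associated perm algebra; the structure is then called compatible with $(A,\circ_A)$) and for all $x,y,z$: $(x\circ_A y)\bullet_A z=x\bullet_A(y\bullet_A z)=y\bullet_A(x\bullet_A z)$ and $z\triangleleft_A(x\circ_A y)=-(z\triangleleft_A y)\triangleleft_A x=x\bullet_A(z\triangleleft_A y)=(x\bullet_A z)\triangleleft_A y$. It is special if $\triangleleft_A$ is commutative. A quadratic special apre-perm algebra is a special one with a nondegenerate symmetric bilinear form $\mathcal B$ with $\mathcal B(x\triangleleft_A y,z)=-\mathcal B(x,z\circ_A y)$. A perm algebra with a nondegenerate symmetric left-invariant bilinear form $\mathcal B$ has an induced compatible special apre-perm algebra structure given by $\mathcal B(x\triangleleft y,z)=-\mathcal B(x,z\circ y)$, $x\triangleright y=x\circ y-x\triangleleft y$. A Manin triple of perm algebras associated to $\mathcal B_d$, $\big((A\oplus A^*,\circ_d,\mathcal B_d),(A,\circ_A),(A^*,\circ_{A^*})\big)$: a perm algebra structure $\circ_d$ on $A\oplus A^*$ containing $(A,\circ_A)$, $(A^*,\circ_{A^*})$ as perm subalgebras with $\mathcal B_d$ left-invariant. A Manin triple of special apre-perm algebras: a quadratic special apre-perm algebra $(A\oplus A^*,\triangleright_d,\triangleleft_d,\mathcal B_d)$ containing $(A,\triangleright_A,\triangleleft_A)$ and $(A^*,\triangleright_{A^*},\triangleleft_{A^*})$ as special apre-perm subalgebras. Linear duals: $\langle a^*\triangleright_{A^*}b^*,x\rangle=\langle a^*\otimes b^*,\vartheta(x)\rangle$, $\langle a^*\triangleleft_{A^*}b^*,x\rangle=\langle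 a^*\otimes b^*,\theta(x)\rangle$. A special apre-perm coalgebra $(A,\vartheta,\theta)$: with $\eta=\vartheta+\theta$, for all $x$: $(\eta\otimes\mathrm{id})\eta(x)=(\mathrm{id}\otimes\eta)\eta(x)$, $(\mathrm{id}\otimes\eta)\eta(x)=(\tau\otimes\mathrm{id})(\eta\otimes\mathrm{id})\eta(x)$, $\theta(x)=\tau\theta(x)$, $(\eta\otimes\mathrm{id})\theta(x)=(\mathrm{id}\otimes\theta)\eta(x)$, $(\mathrm{id}\otimes\theta)(\eta+\theta)(x)=0$. A special apre-perm bialgebra $(A,\triangleright_A,\triangleleft_A,\vartheta,\theta)$ is a special apre-perm algebra $(A,\triangleright_A,\triangleleft_A)$ and a special apre-perm coalgebra $(A,\vartheta,\theta)$ such that for all $x,y\in A$, with $\eta=\vartheta+\theta$ and $\circ_A=\triangleright_A+\triangleleft_A$: (1) $\eta(x\circ_A y)=(\mathcal L_{\circ_A}(x)\otimes\mathrm{id})\eta(y)-(\mathrm{id}\otimes\mathcal R_{\circ_A}(y))\theta(x)$; (2) $\eta(x\circ_A y)=(\mathrm{id}\otimes\mathcal R_{\circ_A}(y))\eta(x)-(\mathcal L_{\triangleleft_A}(x)\otimes\mathrm{id})\eta(y)$; (3) $\eta(x\circ_A y)=(\mathrm{id}\otimes\mathcal L_{\circ_A}(x))\eta(y)+(\mathcal L_{\triangleleft_A}(y)\otimes\mathrm{id})\theta(x)$; (4) $\eta(x\triangleleft_A y)=(\mathrm{id}\otimes\mathcal L_{\triangleleft_A}(x))\eta(y)+\tau(\mathrm{id}\otimes\mathcal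 L_{\triangleleft_A}(y))\eta(x)$; (5) $\eta(x\triangleleft_A y)=\tau\eta(x\triangleleft_A y)$; (6) $\theta(x\circ_A y)=(\mathrm{id}\otimes\mathcal L_{\circ_A}(x))\theta(y)+(\mathcal L_{\circ_A}(y)\otimes\mathrm{id})\theta(x)$; (7) $\theta(x\circ_A y)=\theta(y\circ_A x)$. *)

(* Defs.v *)
From HB Require Import structures.
From mathcomp Require Import all_boot all_order all_algebra.

Set Implicit Arguments.
Unset Strict Implicit.
Unset Printing Implicit Defensive.

Import GRing.Theory.
Local Open Scope ring_scope.

(* A bilinear map U x V -> W is an element of 'Hom(U, 'Hom(V, W)); in         *)
(* particular a bilinear operation on A is an element of 'Hom(A, 'End(A)),    *)
(* which is its own left multiplication map A -> 'End(A).                     *)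

Section Bilinear.
Variables (K : fieldType) (U V W : vectType K).

(* This is f itself when f is bilinear (bilinE), and junk otherwise.          *)
Definition bilin (f : U -> V -> W) : 'Hom(U, 'Hom(V, W)) :=
  linfun (fun x => linfun (f x)).

Lemma linfunE (X Y : vectType K) (f : X -> Y) : linear f -> linfun f =1 f.
Proof.
move=> fL x; pose M := GRing.isLinear.Build K X Y *:%R f fL.
pose F : {linear X -> Y} := HB.pack f M.
exact: (lfunE F).
Qed.

Lemma bilinE (f : U -> V -> W) :
    (forall x, linear (f x)) -> (forall y, linear (f^~ y)) ->
  forall x y, bilin f x y = f x y.
Proof.
move=> fr fl x y; rewrite /bilin linfunE ?linfunE // => k u v.
by apply/lfunP=> w; rewrite !lfun_simp !linfunE // fl.
Qed.

Lemma hom_linearl (m : 'Hom(U, 'Hom(V, W))) k u v y :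
  m (k *: u + v) y = k *: m u y + m v y.
Proof. by rewrite linearP !lfun_simp. Qed.

End Bilinear.

Notation dual V := 'Hom(V, GRing.regular _).
Notation binop A := 'Hom(A, 'End(A)).
Notation bilform V := 'Hom(V, dual V).

Section DualMaps.
Variables (K : fieldType) (X V : vectType K).

Definition bidual : 'Hom(V, dual (dual V)) := bilin (fun x (u : dual V) => u x).

Lemma bidualE x (u : dual V) : bidual x u = u x.
Proof.
by rewrite bilinE // => [y k f g|f k y z]; rewrite ?lfun_simp ?linearP.
Qed.

Notation n := (\dim {:V}%VS).

Definition bvec (i : 'I_n) : V := (vbasis {:V}%VS)`_i.
Definition bdual (i : 'I_n) : dual V :=
  linfun (coord (vbasis {:V}%VS) i : V -> GRing.regular K).

Lemma bdualE i x : bdual i x = coord (vbasis {:V}%VS) i x.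
Proof. by rewrite linfunE // => k u v; rewrite linearP. Qed.

Lemma bvec_sum x : x = \sum_i bdual i x *: bvec i.
Proof.
rewrite {1}[x](coord_vbasis (memvf x)).
by apply: eq_bigr => i _; rewrite bdualE.
Qed.

Lemma bdual_bvec i j : bdual i (bvec j) = (i == j)%:R.
Proof.
rewrite bdualE /bvec coord_free; first by rewrite eq_sym.
exact: basis_free (vbasisP _).
Qed.

Lemma dual_sum (u : dual V) : u = \sum_i u (bvec i) *: bdual i.
Proof.
apply/lfunP=> x; rewrite {1}[x]bvec_sum linear_sum sum_lfunE.
apply: eq_bigr => i _; rewrite linearZ scale_lfunE.
by rewrite /GRing.scale /= mulrC.
Qed.

Lemma bidual_surj (F : dual (dual V)) : exists x, F = bidual x.
Proof.
exists (\sum_i F (bdual i) *: bvec i); apply/lfunP=> u.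
rewrite bidualE {1}[u]dual_sum !linear_sum; apply: eq_bigr => i _.
by rewrite !linearZ /= /GRing.scale /= mulrC.
Qed.

Lemma bidual_inj : injective bidual.
Proof.
move=> x y e; rewrite [x]bvec_sum [y]bvec_sum; apply: eq_bigr => i _.
by have /lfunP/(_ (bdual i)) := e; rewrite !bidualE => ->.
Qed.

(* The inverse of bidual, i.e. the identification of V** with V.              *)
Definition undual : 'Hom(dual (dual V), V) := (bidual^-1)%VF.

Lemma bidualK : cancel bidual undual.
Proof. by apply: lker0_lfunK; apply/lker0P; exact: bidual_inj. Qed.

Lemma undualE (F : dual (dual V)) (u : dual V) : u (undual F) = F u.
Proof. by have [x ->] := bidual_surj F; rewrite bidualK bidualE. Qed.

(* mu^* : X -> End(V* ), without a sign.                                      *)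
Definition dualrep (mu : 'Hom(X, 'End(V))) : 'Hom(X, 'End(dual V)) :=
  bilin (fun x (u : dual V) => (u \o mu x)%VF).

Lemma dualrepE mu x (u : dual V) v : dualrep mu x u v = u (mu x v).
Proof.
rewrite bilinE ?comp_lfunE // => y k f g; apply/lfunP=> w.
  by rewrite !lfun_simp.
by rewrite linearP !lfun_simp linearP.
Qed.

End DualMaps.

Arguments bidual {K V}.
Arguments undual {K V}.

(* mu^* for mu acting on V*, seen as acting on V instead of V**.              *)
Definition predualrep (K : fieldType) (X V : vectType K)
    (mu : 'Hom(X, 'End(dual V))) : 'Hom(X, 'End(V)) :=
  bilin (fun x v => undual (dualrep mu x (bidual v))).

Lemma predualrepE (K : fieldType) (X V : vectType K)
    (mu : 'Hom(X, 'End(dual V))) x (u : dual V) v :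
  u (predualrep mu x v) = mu x u v.
Proof.
rewrite bilinE ?undualE ?dualrepE ?bidualE // => y k f g; rewrite ?linearP //.
by rewrite add_lfunE scale_lfunE linearP.
Qed.

Section Tensor.
Variable K : fieldType.

(* U (x) V as the space of matrices of coordinates in the basis               *)
(* bvec i (x) bvec j; tpure u v is u (x) v, and tliftE and tens_ext below are *)
(* the universal property.                                                    *)
Definition tens (U V : vectType K) : Type :=
  'M[K]_(\dim {:U}%VS, \dim {:V}%VS).
HB.instance Definition _ (U V : vectType K) :=
  Vector.copy (tens U V) 'M[K]_(\dim {:U}%VS, \dim {:V}%VS).

Variables U V W : vectType K.

Definition tpure (u : U) (v : V) : tens U V :=
  \matrix_(i, j) (bdual i u * bdual j v).

Definition tlift (B : U -> V -> W) : 'Hom(tens U V, W) :=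
  linfun (fun t : tens U V =>
    \sum_i \sum_j (t : 'M[K]_(_, _)) i j *: B (bvec i) (bvec j)).

Lemma tpure_linearl v : linear (tpure^~ v).
Proof.
by move=> k x y; apply/matrixP=> i j; rewrite !mxE linearP mulrDl -scalerAl.
Qed.

Lemma tpure_linearr u : linear (tpure u).
Proof.
by move=> k x y; apply/matrixP=> i j; rewrite !mxE linearP mulrDr -scalerAr.
Qed.

Lemma tliftEsum (B : U -> V -> W) (t : tens U V) :
  tlift B t = \sum_i \sum_j (t : 'M[K]_(_, _)) i j *: B (bvec i) (bvec j).
Proof.
rewrite linfunE // => k s r; rewrite scaler_sumr -big_split.
apply: eq_bigr => i _; rewrite scaler_sumr -big_split; apply: eq_bigr => j _.
by rewrite !mxE scalerDl scalerA.
Qed.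

Lemma tliftE (B : U -> V -> W) :
    (forall x, linear (B x)) -> (forall y, linear (B^~ y)) ->
  forall u v, tlift B (tpure u v) = B u v.
Proof.
move=> Br Bl u v; rewrite -(bilinE Br Bl) {2}[u]bvec_sum linear_sum sum_lfunE.
rewrite tliftEsum; apply: eq_bigr => i _.
rewrite linearZ scale_lfunE {2}[v]bvec_sum linear_sum scaler_sumr.
apply: eq_bigr => j _; rewrite linearZ /= scalerA bilinE //.
by rewrite mxE.
Qed.

Lemma tens_sum (t : tens U V) :
  t = \sum_i \sum_j (t : 'M[K]_(_, _)) i j *: tpure (bvec i) (bvec j).
Proof.
rewrite {1}[t]matrix_sum_delta; apply: eq_bigr => i _; apply: eq_bigr => j _.
congr (_ *: _); apply/matrixP=> a b; rewrite !mxE !bdual_bvec.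
by rewrite -mulnb natrM.
Qed.

Lemma tens_ext (f g : 'Hom(tens U V, W)) :
  (forall u v, f (tpure u v) = g (tpure u v)) -> f = g.
Proof.
move=> fg; apply/lfunP=> t; rewrite [t]tens_sum !linear_sum.
apply: eq_bigr => i _; rewrite !linear_sum.
by apply: eq_bigr => j _; rewrite !linearZ /= fg.
Qed.

End Tensor.

Section TensorMaps.
Variables (K : fieldType) (U V W U' V' : vectType K).

Definition tmap (f : 'Hom(U, U')) (g : 'Hom(V, V')) :
    'Hom(tens U V, tens U' V') :=
  tlift (fun u v => tpure (f u) (g v)).

Lemma tmapE f g u v : tmap f g (tpure u v) = tpure (f u) (g v).
Proof.
rewrite tliftE // => [x|y] k a b; rewrite linearP.
  exact: tpure_linearr.
exact: tpure_linearl.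
Qed.

Definition tflip : 'Hom(tens U V, tens V U) := tlift (fun u v => tpure v u).

Lemma tflipE u v : tflip (tpure u v) = tpure v u.
Proof.
rewrite tliftE // => [x|y] k a b; first exact: tpure_linearl.
exact: tpure_linearr.
Qed.

Definition tassoc : 'Hom(tens (tens U V) W, tens U (tens V W)) :=
  tlift (fun t w => tlift (fun u v => tpure u (tpure v w)) t).

Lemma tassocE u v w : tassoc (tpure (tpure u v) w) = tpure u (tpure v w).
Proof.
have lE w' u' v' : tlift (fun u v => tpure u (tpure v w')) (tpure u' v')
    = tpure u' (tpure v' w').
  rewrite tliftE // => [x|y] k a b; last exact: tpure_linearl.
  by rewrite tpure_linearl tpure_linearr.
rewrite tliftE ?lE // => [t|w'] k a b; last by rewrite linearP.
rewrite -scale_lfunE -add_lfunE; congr (fun_of_lfun _ t).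
by apply: tens_ext => x y; rewrite add_lfunE scale_lfunE !lE !tpure_linearr.
Qed.

Definition tpair (a : dual U) (b : dual V) : dual (tens U V) :=
  tlift (fun u v => a u * b v : GRing.regular K).

Lemma tpairE a b u v : tpair a b (tpure u v) = a u * b v.
Proof.
rewrite tliftE // => [x|y] k c d; rewrite linearP /=.
  by rewrite mulrDr mulrCA.
by rewrite mulrDl -scalerAl.
Qed.

End TensorMaps.

Arguments tflip {K U V}.
Arguments tassoc {K U V W}.

Section Algebras.
Variables (K : fieldType) (A : vectType K).
Implicit Types (o tr tl m : binop A) (B : bilform A).

Definition Lop m : binop A := m.
Definition Rop m : binop A := bilin (fun x y => m y x).

Lemma RopE m x y : Rop m x y = m y x.
Proof. by rewrite bilinE // => z k u v; rewrite linearP ?lfun_simp. Qed.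

Definition perm_algebra o :=
  forall x y z, o x (o y z) = o (o x y) z /\ o (o x y) z = o (o y x) z.

Definition apreperm_algebra tr tl :=
  let o := tr + tl in
  let bu x y := tr x y + tl y x in
  perm_algebra o /\
  forall x y z,
    [/\ bu (o x y) z = bu x (bu y z) /\ bu x (bu y z) = bu y (bu x z),
        tl z (o x y) = - tl (tl z y) x,
        - tl (tl z y) x = bu x (tl z y)
      & bu x (tl z y) = tl (bu x z) y].

Definition special_apreperm_algebra tr tl :=
  apreperm_algebra tr tl /\ forall x y, tl x y = tl y x.

Definition symmetric_form B := forall x y, B x y = B y x.
Definition nondegenerate B := forall x, (forall y, B x y = 0) -> x = 0.
Definition left_invariant o B := forall x y z, B (o x y) z = B y (o x z).

Definition quadratic_perm_algebra o B :=
  [/\ perm_algebra o, symmetric_form B, nondegenerate B & left_invariant o B].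

Definition quadratic_special_apreperm_algebra tr tl B :=
  [/\ special_apreperm_algebra tr tl, symmetric_form B, nondegenerate B
    & forall x y z, B (tl x y) z = - B x ((tr + tl) z y)].

(* By nondegeneracy of B the pair (tr, tl) exists and is unique.              *)
Definition induced_apreperm o B tr tl :=
  (forall x y z, B (tl x y) z = - B x (o z y)) /\
  (forall x y, tr x y = o x y - tl x y).

Lemma induced_apreperm_unique o B tr tl tr' tl' : nondegenerate B ->
  induced_apreperm o B tr tl -> induced_apreperm o B tr' tl' ->
  tr = tr' /\ tl = tl'.
Proof.
move=> nB [tlE trE] [tlE' trE'].
have e x y : tl x y = tl' x y.
  apply/eqP; rewrite -subr_eq0; apply/eqP/nB => z.
  by rewrite linearB !lfun_simp tlE tlE' subrr.
by split; apply/lfunP=> x; apply/lfunP=> y; rewrite ?trE ?trE' e.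
Qed.

Lemma induced_apreperm_exists o B : nondegenerate B ->
  exists tr tl, induced_apreperm o B tr tl.
Proof.
move=> nB; have B0 : lker B = 0%VS.
  apply/eqP/lker0P => x y e; apply/eqP; rewrite -subr_eq0; apply/eqP/nB => z.
  by rewrite linearB /= e subrr lfun_simp.
have Bs : limg B = fullv.
  apply/eqP; rewrite eqEdim subvf /= limg_dim_eq ?B0 ?capv0 //.
  by rewrite !dimvf /dim /= muln1.
have BK u : B ((B^-1)%VF u) = u by apply: limg_lfunVK; rewrite Bs memvf.
pose tl := bilin (fun x y => (B^-1)%VF (- (B x \o Rop o y)%VF)).
have tlE x y : B (tl x y) = - (B x \o Rop o y)%VF.
  rewrite bilinE ?BK // => [u k v w|v k u w]; rewrite -linearP;
    congr ((B^-1)%VF _); apply/lfunP=> z; rewrite !lfun_simp !RopE.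
    by rewrite linearP [B u _]linearP opprD scalerN.
  by rewrite hom_linearl opprD scalerN.
exists (o - tl), tl; split=> [x y z|x y]; last by rewrite !lfun_simp.
by rewrite tlE !lfun_simp RopE.
Qed.

(* The comultiplication on A linearly dual to a multiplication on A*.         *)
Definition codual (m : binop (dual A)) : 'Hom(A, tens A A) :=
  linfun (fun x : A => \matrix_(i, j) m (bdual i) (bdual j) x : tens A A).

Lemma codualE (m : binop (dual A)) x i j :
  (codual m x : 'M[K]_(_, _)) i j = m (bdual i) (bdual j) x.
Proof.
rewrite linfunE ?mxE // => k u v.
by apply/matrixP=> r s; rewrite !mxE linearP.
Qed.

Lemma codualP (m : binop (dual A)) (a b : dual A) x :
  m a b x = tpair a b (codual m x).
Proof.
rewrite /tpair tliftEsum {1}[a]dual_sum linear_sum !sum_lfunE.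
apply: eq_bigr => i _; rewrite linearZ !scale_lfunE {1}[b]dual_sum.
rewrite linear_sum sum_lfunE scaler_sumr; apply: eq_bigr => j _.
rewrite linearZ scale_lfunE codualE /GRing.scale /=.
by rewrite mulrA mulrC.
Qed.

(* The two sides of an identity in A (x) A (x) A are compared in              *)
(* tens A (tens A A).                                                         *)
Definition special_apreperm_coalgebra (vartheta theta : 'Hom(A, tens A A)) :=
  let eta := vartheta + theta in
  let idA := (\1%VF : 'End(A)) in
  forall x,
    [/\ tassoc (tmap eta idA (eta x)) = tmap idA eta (eta x),
        tmap idA eta (eta x)
        = tassoc (tmap tflip idA (tmap eta idA (eta x))),
        theta x = tflip (theta x),
        tassoc (tmap eta idA (theta x)) = tmap idA theta (eta x)
      & tmap idA theta ((eta + theta) x) = 0].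

Definition special_apreperm_bialgebra tr tl
    (vartheta theta : 'Hom(A, tens A A)) :=
  let eta := vartheta + theta in
  let o := tr + tl in
  let idA := (\1%VF : 'End(A)) in
  let tau := (tflip : 'End(tens A A)) in
  [/\ special_apreperm_algebra tr tl,
      special_apreperm_coalgebra vartheta theta
    & forall x y,
      [/\ eta (o x y)
          = tmap (Lop o x) idA (eta y) - tmap idA (Rop o y) (theta x),
          eta (o x y)
          = tmap idA (Rop o y) (eta x) - tmap (Lop tl x) idA (eta y),
          eta (o x y)
          = tmap idA (Lop o x) (eta y) + tmap (Lop tl y) idA (theta x),
          eta (tl x y)
          = tmap idA (Lop tl x) (eta y) + tau (tmap idA (Lop tl y) (eta x))
        & [/\ eta (tl x y) = tau (eta (tl x y)),
              theta (o x y)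
              = tmap idA (Lop o x) (theta y) + tmap (Lop o y) idA (theta x)
            & theta (o x y) = theta (o y x)]]].

End Algebras.

Section Doubles.
Variables (K : fieldType) (A : vectType K).

Notation D := (A * dual A)%type.

Definition formd : bilform D := bilin (fun u v : D => v.2 u.1 + u.2 v.1).

Lemma formdE (x y : A) (a b : dual A) : formd (x, a) (y, b) = b x + a y.
Proof.
rewrite bilinE // => u k [y1 b1] [y2 b2] /=.
  by rewrite !lfun_simp !linearP /= scalerDr addrACA.
by rewrite !lfun_simp !linearP /= scalerDr addrACA.
Qed.

Lemma formd_sym : symmetric_form formd.
Proof. by case=> x a [y b]; rewrite !formdE addrC. Qed.

Lemma formd_nondegenerate : nondegenerate formd.
Proof.
case=> x a h; have x0 : x = 0.
  apply: bidual_inj; apply/lfunP=> b; rewrite !bidualE linear0.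
  by have := h (0, b); rewrite formdE linear0 addr0.
have -> : a = 0; last by rewrite x0.
apply/lfunP=> y; rewrite lfun_simp.
by have := h (y, 0); rewrite formdE lfun_simp add0r.
Qed.

(* m, on A (+) A*, extends mA and mS along the canonical inclusions.          *)
Definition extends (m : binop D) (mA : binop A) (mS : binop (dual A)) :=
  (forall x y, m (x, 0) (y, 0) = (mA x y, 0)) /\
  (forall a b, m (0, a) (0, b) = (0, mS a b)).

Definition manin_triple_perm (od : binop D) (oA : binop A)
    (oS : binop (dual A)) :=
  [/\ perm_algebra oA, perm_algebra oS, quadratic_perm_algebra od formd
    & extends od oA oS].

Definition manin_triple_special_apreperm (trd tld : binop D)
    (trA tlA : binop A) (trS tlS : binop (dual A)) :=
  [/\ special_apreperm_algebra trA tlA, special_apreperm_algebra trS tlS,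
      quadratic_special_apreperm_algebra trd tld formd,
      extends trd trA trS & extends tld tlA tlS].

End Doubles.

(* Main.v *)
From HB Require Import structures.
From mathcomp Require Import all_boot all_order all_algebra.
From mathcomp Require Import ring.
Require Import Defs.
Import GRing.Theory.
Local Open Scope ring_scope.

(** Write e for the pairing of the dual S of A with A, and B for the form on
    the double of A and S.  Everything happens in one quadratic space: B turns
    the second product tl of a special apre-perm structure into the adjoint of
    the associated product o, via B (tl u v) w = - B u (o w v) with tl
    commutative, and conversely a perm product with a nondegenerate symmetric
    left-invariant form defines such a tl.  So both kinds of Manin triple describe the
    same objects [induced_quadratic_special].  The adjunction also forces all products of an
    element of A with one of S, because B pairs the result with A and with S
    through products taken inside S and inside A; this yields the
    explicit formulas [invariant_formula].  Conversely these formulas always define a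
    bilinear structure satisfying the adjunction [double_formula_exists,
    formula_invariant], and the single remaining question is whether o is perm.

    That question is quadrilinear.  Moving one factor across B rewrites
    perm-ness of o as two identities between the values
    B (o v w) (o u t), B (o u v) (tl w t) and B (o v u) (tl w t)
    [perm_via_form], in which only products of two arguments occur; they may be
    tested with each argument in A or in S.  If at most one argument lies in S,
    or at most one in A, the identities are axioms of A, respectively of S.
    With two arguments on each side they are exactly the seven compatibility
    conditions of a bialgebra, each paired with an element a (x) b
    [perm_scalar, scalar_perm, bialgebra_compatP].  The coalgebra axioms
    are those of S, paired with a (x) b (x) c [comul_coalgebra].

    The argument is carried out for abstract vector spaces A, S, V with a
    pairing e and a map p identifying A x S with V; only afterwards are S and V
    specialized to the dual of A and the direct sum. *)

Set Implicit Arguments.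
Unset Strict Implicit.
Unset Printing Implicit Defensive.

(** * Special apre-perm algebras and invariant forms *)

Section Algebras.
Variables (K : fieldType) (A : vectType K).
Implicit Types (o tr tl : binop A) (B : bilform A).

(** Commutativity of [tl] makes the product written with a bullet equal to [o],
    so the remaining axioms collapse to two. *)
Lemma special_aprepermP tr tl : let o := tr + tl in
  special_apreperm_algebra tr tl <->
  [/\ perm_algebra o, forall x y, tl x y = tl y x,
      forall x y z, tl (o x y) z = o x (tl y z)
    & forall x y z, o x (tl y z) = - tl x (tl y z)].
Proof.
move=> o; split=> [[[oP ap] tlC] | [oP tlC otl ottl]].
  have buE x y : tr x y + tl y x = o x y by rewrite tlC /o !add_lfunE.
  split=> // x y z; have [_ _ e2 e3] := ap x z y; rewrite !buE in e2 e3.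
    by rewrite e3.
  by rewrite -e2 tlC.
have buE x y : tr x y + tl y x = o x y by rewrite tlC /o !add_lfunE.
split=> //; split=> // x y z; rewrite -/o !buE.
have [pA pC] := oP x y z.
split; first by split; rewrite // pA pC; case: (oP y x z).
- by rewrite tlC otl ottl tlC [tl y z]tlC.
- by rewrite ottl tlC.
- by rewrite otl.
Qed.

Lemma nondegenerate_inj B (u v : A) :
  nondegenerate B -> (forall w, B u w = B v w) -> u = v.
Proof.
move=> nB uv; apply/eqP; rewrite -subr_eq0; apply/eqP/nB => w.
by rewrite linearB !lfun_simp uv subrr.
Qed.

(** Each axiom for [tl] is, after pairing with a test vector and moving factors
    across [B], an instance of the perm identities for [o]. *)
Lemma induced_quadratic_special o B tr tl :
  quadratic_perm_algebra o B -> induced_apreperm o B tr tl ->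
  quadratic_special_apreperm_algebra tr tl B.
Proof.
move=> [oP Bsym Bnd Binv] [tlE trE].
have oE : tr + tl = o.
  by apply/lfunP=> x; apply/lfunP=> y; rewrite !add_lfunE trE subrK.
split=> //; last by rewrite oE.
have tlC x y : tl x y = tl y x.
  by apply: (nondegenerate_inj Bnd) => w; rewrite !tlE Bsym Binv.
apply/special_aprepermP; rewrite oE.
split=> // x y z; apply: (nondegenerate_inj Bnd) => w; rewrite ?linearN ?opp_lfunE.
  by rewrite tlE !Binv tlE; case: (oP x w z) => ->.
by rewrite Binv tlE tlC !tlE opprK; case: (oP x w z) => _ ->.
Qed.

Section InvariantForm.
Variables (o tl : binop A) (B : bilform A).
Hypotheses (Bsym : symmetric_form B) (Bnd : nondegenerate B).
Hypotheses (tlC : forall u v, tl u v = tl v u).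
Hypothesis inv : forall u v w, B (tl u v) w = - B u (o w v).

Lemma invariant_opl u v w : B (o u v) w = - B (tl v w) u.
Proof. by rewrite [tl v w]tlC inv opprK Bsym. Qed.

Lemma invariant_opr u v w : B (o u v) w = - B u (tl v w).
Proof. by rewrite invariant_opl Bsym. Qed.

Lemma invariant_left : left_invariant o B.
Proof. by move=> u v w; rewrite invariant_opl inv opprK. Qed.

(** In this form each argument is multiplied only once, so on a double the
    identities can be evaluated from the table of products alone. *)
Lemma perm_via_form :
  perm_algebra o <->
  forall u v w t, B (o v w) (o u t) = - B (o u v) (tl w t) /\
                  B (o u v) (tl w t) = B (o v u) (tl w t).
Proof.
split=> [P u v w t | Q u v w].
  have [P1 P2] := P u v w.
  split; first by rewrite -invariant_left P1 invariant_opr.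
  by apply: oppr_inj; rewrite -2!invariant_opr P2.
split; apply: (nondegenerate_inj Bnd) => t; have [Q1 Q2] := Q u v w t.
  by rewrite [LHS]invariant_left Q1 [RHS]invariant_opr.
by rewrite [LHS]invariant_opr [RHS]invariant_opr Q2.
Qed.

End InvariantForm.

End Algebras.

(** Instances of linearity stated for [fun_of_lfun], so that rewriting does not
    have to search for a linear structure. *)
Lemma lfunN (K : fieldType) (U V : vectType K) (f : 'Hom(U, V)) u : f (- u) = - f u.
Proof. exact: linearN. Qed.

Lemma lfun0 (K : fieldType) (U V : vectType K) (f : 'Hom(U, V)) : f 0 = 0.
Proof. exact: linear0. Qed.

Lemma lfunD (K : fieldType) (U V : vectType K) (f : 'Hom(U, V)) u v : f (u + v) = f u + f v.
Proof. exact: linearD. Qed.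

Lemma lfun2Nl (K : fieldType) (U V W : vectType K) (f : 'Hom(U, 'Hom(V, W))) u v :
  f (- u) v = - f u v.
Proof. by rewrite lfunN opp_lfunE. Qed.

Lemma lfun20l (K : fieldType) (U V W : vectType K) (f : 'Hom(U, 'Hom(V, W))) v :
  f 0 v = 0.
Proof. by rewrite lfun0 zero_lfunE. Qed.

Lemma lfunL (K : fieldType) (U V : vectType K) (f : 'Hom(U, V)) k u v :
  f (k *: u + v) = k *: f u + f v.
Proof. exact: linearP. Qed.

(** * The double of two paired algebras *)

Section Double.
Variables (K : fieldType) (A S V : vectType K).
Variables (e : S -> A -> K^o) (p : A -> S -> V) (prA : V -> A) (prS : V -> S).
Variable B : bilform V.
Hypothesis eLl : forall k a b x, e (k *: a + b) x = k * e a x + e b x.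
Hypothesis eLr : forall k a x y, e a (k *: x + y) = k * e a x + e a y.
Hypothesis pL : forall k x y a b,
  p (k *: x + y) (k *: a + b) = k *: p x a + p y b.
Hypothesis pK : forall u, p (prA u) (prS u) = u.
Hypothesis pAE : forall x a, prA (p x a) = x.
Hypothesis pSE : forall x a, prS (p x a) = a.
Hypothesis BE : forall x y a b, B (p x a) (p y b) = e b x + e a y.
Hypotheses (Bsym : symmetric_form B) (Bnd : nondegenerate B).

Lemma eDl a b x : e (a + b) x = e a x + e b x.
Proof. by rewrite -[a in LHS]scale1r eLl mul1r. Qed.

Lemma eDr a x y : e a (x + y) = e a x + e a y.
Proof. by rewrite -[x in LHS]scale1r eLr mul1r. Qed.

Lemma pD x y a b : p (x + y) (a + b) = p x a + p y b.
Proof. by rewrite -[x in LHS]scale1r -[a in LHS]scale1r pL scale1r. Qed.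

Lemma p_surj u : exists x a, u = p x a.
Proof. by exists (prA u), (prS u); rewrite pK. Qed.

Lemma pAL k u v : prA (k *: u + v) = k *: prA u + prA v.
Proof. by rewrite -[u in LHS]pK -[v in LHS]pK -pL pAE. Qed.

Lemma pSL k u v : prS (k *: u + v) = k *: prS u + prS v.
Proof. by rewrite -[u in LHS]pK -[v in LHS]pK -pL pSE. Qed.

Lemma e0l x : e 0 x = 0.
Proof. by apply: (addrI (e 0 x)); rewrite -eDl !addr0. Qed.

Lemma e0r a : e a 0 = 0.
Proof. by apply: (addrI (e a 0)); rewrite -eDr !addr0. Qed.

Lemma eNl a x : e (- a) x = - e a x.
Proof. by apply: (addrI (e a x)); rewrite -eDl !subrr e0l. Qed.

Lemma eNr a x : e a (- x) = - e a x.
Proof. by apply: (addrI (e a x)); rewrite -eDr !subrr e0r. Qed.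

Lemma split_pair x a : p x a = p x 0 + p 0 a.
Proof. by rewrite -pD addr0 add0r. Qed.

Lemma pair_eq u v :
  (forall z, B u (p z 0) = B v (p z 0)) -> (forall c, B u (p 0 c) = B v (p 0 c)) ->
  u = v.
Proof.
move=> uv1 uv2; apply: (nondegenerate_inj Bnd) => w.
by have [z [c ->]] := p_surj w; rewrite split_pair !lfunD uv1 uv2.
Qed.

Definition pure u := (exists x, u = p x 0) \/ (exists a, u = p 0 a).

Lemma pure_ind (P : V -> Prop) :
  (forall u v, P u -> P v -> P (u + v)) -> (forall u, pure u -> P u) ->
  forall u, P u.
Proof.
move=> PD Pp u; have [x [a ->]] := p_surj u; rewrite split_pair.
by apply: PD; apply: Pp; [left; exists x | right; exists a].
Qed.

(** The additivity of a quadrilinear identity in each slot is checked once for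
    arbitrary arguments, instead of once per branch of a nested induction. *)
Lemma pure_ind4 (P : V -> V -> V -> V -> Prop) :
  (forall u u' v w t, P u v w t -> P u' v w t -> P (u + u') v w t) ->
  (forall u v v' w t, P u v w t -> P u v' w t -> P u (v + v') w t) ->
  (forall u v w w' t, P u v w t -> P u v w' t -> P u v (w + w') t) ->
  (forall u v w t t', P u v w t -> P u v w t' -> P u v w (t + t')) ->
  (forall u v w t, pure u -> pure v -> pure w -> pure t -> P u v w t) ->
  forall u v w t, P u v w t.
Proof.
move=> P1 P2 P3 P4 Pp u v w t.
elim/pure_ind: u => [u u'|u hu]; first exact: P1.
elim/pure_ind: v => [v v'|v hv]; first exact: P2.
elim/pure_ind: w => [w w'|w hw]; first exact: P3.
elim/pure_ind: t => [t t'|t ht]; first exact: P4.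
exact: Pp.
Qed.

Lemma p_ext x y a b :
  (forall c, e c x = e c y) -> (forall z, e a z = e b z) -> p x a = p y b.
Proof. by move=> xy ab; apply: pair_eq => w; rewrite !BE ?e0r ?e0l ?xy ?ab. Qed.

Definition glues (m : binop V) (mA : binop A) (mS : binop S) :=
  (forall x y, m (p x 0) (p y 0) = p (mA x y) 0) /\
  (forall a b, m (p 0 a) (p 0 b) = p 0 (mS a b)).

Variables (oA trA tlA : binop A) (oS trS tlS : binop S).
Hypotheses (oAE : trA + tlA = oA) (oSE : trS + tlS = oS).
(* Transposes of multiplications.  On A: L is left and R right                *)
(* multiplication by x for o, Q is multiplication by x for tl, M is L + R, and *)
(* T is right multiplication by x for tr; similarly on S.                      *)
Variables (LA RA QA MA TA : A -> S -> S) (MS RS TS : S -> A -> A).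
Hypothesis eLA : forall x b y, e (LA x b) y = e b (oA x y).
Hypothesis eRA : forall x b y, e (RA x b) y = e b (oA y x).
Hypothesis eQA : forall x b y, e (QA x b) y = e b (tlA y x).
Hypothesis eMA : forall x b y, e (MA x b) y = e b (oA x y) + e b (oA y x).
Hypothesis eTA : forall x b y, e (TA x b) y = e b (trA y x).
Hypothesis eMS : forall a y b, e b (MS a y) = e (oS a b) y + e (oS b a) y.
Hypothesis eRS : forall a y b, e b (RS a y) = e (oS b a) y.
Hypothesis eTS : forall a y b, e b (TS a y) = e (trS b a) y.

Definition LS a y := MS a y - RS a y.
Definition QS a y := RS a y - TS a y.

Lemma eLS a y b : e b (LS a y) = e (oS a b) y.
Proof. by rewrite eDr eNr eMS eRS addrK. Qed.

Lemma eQS a y b : e b (QS a y) = e (tlS b a) y.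
Proof.
by rewrite eDr eNr eRS eTS -oSE !add_lfunE eDl addrAC subrr add0r.
Qed.

(** The transposes on A applied backwards.  They are used only when the
    argument moved across [e] is a transpose of S, which can then be expanded in
    turn; unrestricted, they would undo [eLA], [eRA] and [eQA]. *)
Lemma e_oA_l b v y : e b (oA v y) = e (RA y b) v. Proof. by rewrite eRA. Qed.
Lemma e_oA_r b x v : e b (oA x v) = e (LA x b) v. Proof. by rewrite eLA. Qed.
Lemma e_tlA_l b v y : e b (tlA v y) = e (QA y b) v. Proof. by rewrite eQA. Qed.

Definition foldE := (fun b s y => e_oA_l b (LS s y), fun b s y => e_oA_l b (RS s y),
  fun b s y => e_oA_l b (QS s y), fun b x s y => e_oA_r b x (LS s y),
  fun b x s y => e_oA_r b x (RS s y), fun b x s y => e_oA_r b x (QS s y),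
  fun b s y => e_tlA_l b (LS s y), fun b s y => e_tlA_l b (RS s y),
  fun b s y => e_tlA_l b (QS s y)).

Definition pairingE := (foldE, eMA, eTA, eMS, eTS, eLS, eRS, eQS, eLA, eRA,
  eQA, eNl, eNr, e0l, e0r, @lfunN, @lfun2Nl, @lfun0, @lfun20l, @oppr0, @opprK, @addr0, @add0r).

(** [o] and [tl] determine each other through [B], so the double is described
    by this pair rather than by [tr] and [tl]. *)
Definition invariant_double (o tl : binop V) :=
  [/\ glues o oA oS, glues tl tlA tlS, forall u v, tl u v = tl v u
    & forall u v w, B (tl u v) w = - B u (o w v)].

Definition explicit_double (o tl : binop V) :=
  (forall x y a b, o (p x a) (p y b) =
     p (oA x y + LS a y - QS b x) (oS a b + LA x b - QA y a)) /\
  (forall x y a b, tl (p x a) (p y b) =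
     p (tlA x y - RS a y - RS b x) (tlS a b - RA x b - RA y a)).

Section Products.
Variables o tl : binop V.
Hypothesis dbl : invariant_double o tl.

Let oAe x y : o (p x 0) (p y 0) = p (oA x y) 0. Proof. by case: dbl => -[]. Qed.
Let oSe a b : o (p 0 a) (p 0 b) = p 0 (oS a b). Proof. by case: dbl => -[]. Qed.
Let tlAe x y : tl (p x 0) (p y 0) = p (tlA x y) 0.
Proof. by case: dbl => _ []. Qed.
Let tlSe a b : tl (p 0 a) (p 0 b) = p 0 (tlS a b).
Proof. by case: dbl => _ []. Qed.
Let tlC : forall u v, tl u v = tl v u. Proof. by case: dbl. Qed.
Let inv : forall u v w, B (tl u v) w = - B u (o w v). Proof. by case: dbl. Qed.
Let o_form := invariant_opl Bsym tlC inv.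

(** Paired with A the product is read off from [o] on A, paired with S from [o]
    on S; since [B] is nondegenerate this determines it. *)
Lemma tl_mixed x b : tl (p x 0) (p 0 b) = p (- RS b x) (- RA x b).
Proof.
by apply: pair_eq => [z|c]; [rewrite tlC inv oAe | rewrite inv oSe];
  rewrite !BE !pairingE.
Qed.

Lemma o_mixedl x b : o (p x 0) (p 0 b) = p (- QS b x) (LA x b).
Proof.
apply: pair_eq => [z|c]; rewrite o_form tlC.
  by rewrite tl_mixed !BE !pairingE.
by rewrite tlSe !BE !pairingE.
Qed.

Lemma o_mixedr y a : o (p 0 a) (p y 0) = p (LS a y) (- QA y a).
Proof.
apply: pair_eq => [z|c]; rewrite o_form.
  by rewrite tlC tlAe !BE !pairingE.
by rewrite tl_mixed !BE !pairingE.
Qed.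

Lemma invariant_explicit : explicit_double o tl.
Proof.
split=> x y a b; rewrite [p x a]split_pair [p y b]split_pair !lfunD !add_lfunE.
  rewrite oAe oSe o_mixedl o_mixedr -!pD !(addr0, add0r).
  by congr p; rewrite addrC [LA _ _ + _]addrC.
rewrite tlAe tlSe [tl (p 0 a) (p y 0)]tlC !tl_mixed -!pD !(addr0, add0r).
by congr p; rewrite addrC [- _ + _]addrC.
Qed.

End Products.

Lemma p_sub x y a b : p x a - p y b = p (x - y) (a - b).
Proof. by apply/eqP; rewrite subr_eq -pD !subrK. Qed.

Definition double_formula (tr tl : binop V) :=
  (forall x y a b, tr (p x a) (p y b) =
     p (trA x y + MS a y + TS b x) (trS a b + MA x b + TA y a)) /\
  (forall x y a b, tl (p x a) (p y b) =
     p (tlA x y - RS a y - RS b x) (tlS a b - RA x b - RA y a)).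

Lemma invariant_formula tr tl :
  invariant_double (tr + tl) tl -> double_formula tr tl.
Proof.
move=> /invariant_explicit [oE tlE]; split=> // x y a b.
have -> : tr (p x a) (p y b) = (tr + tl) (p x a) (p y b) - tl (p x a) (p y b).
  by rewrite !add_lfunE addrK.
rewrite oE tlE p_sub; apply: p_ext => w;
  rewrite !(eDl, eDr, pairingE) -?oAE -?oSE ?(add_lfunE, eDl, eDr); ring.
Qed.

Lemma formula_invariant tr tl :
    (forall x y, tlA x y = tlA y x) -> (forall a b, tlS a b = tlS b a) ->
  double_formula tr tl -> invariant_double (tr + tl) tl.
Proof.
move=> tlAC tlSC [trE tlE].
have tlC u v : tl u v = tl v u.
  have [x [a ->]] := p_surj u; have [y [b ->]] := p_surj v.
  by rewrite !tlE tlAC tlSC; congr p; rewrite addrAC.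
split=> //.
- by split=> [x y|a b]; rewrite !add_lfunE trE tlE -pD; apply: p_ext => w;
    rewrite !(eDl, eDr, pairingE) -?oAE -?oSE ?(add_lfunE, eDl, eDr).
- by split=> [x y|a b]; rewrite tlE; apply: p_ext => w;
    rewrite !(eDl, eDr, pairingE).
move=> u v w; have [x [a ->]] := p_surj u; have [y [b ->]] := p_surj v.
have [z [c ->]] := p_surj w.
rewrite !add_lfunE !trE !tlE -pD !BE !(eDl, eDr, pairingE) -?oAE -?oSE ?(add_lfunE, eDl, eDr).
ring.
Qed.

(** The transposes are bare functions here: their bilinearity is recovered by
    pairing with [e], which separates points. *)
Lemma double_formula_exists : exists tr tl, double_formula tr tl.
Proof.
pose f u v := p (trA (prA u) (prA v) + MS (prS u) (prA v) + TS (prS v) (prA u))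
                (trS (prS u) (prS v) + MA (prA u) (prS v) + TA (prA v) (prS u)).
pose g u v := p (tlA (prA u) (prA v) - RS (prS u) (prA v) - RS (prS v) (prA u))
                (tlS (prS u) (prS v) - RA (prA u) (prS v) - RA (prA v) (prS u)).
have simpL := (pAL, pSL, @lfunL K, @hom_linearl K, eLl, eLr, eDl, eDr, eNl, eNr,
  eMA, eTA, eRA, eMS, eRS, eTS).
have fr u : linear (f u).
  move=> k v w; rewrite -pL; apply: p_ext => c; rewrite !simpL.
ring. ring.
have fl v : linear (f^~ v).
  by move=> k u w; rewrite -pL; apply: p_ext => c; rewrite !simpL; ring.
have gr u : linear (g u).
  by move=> k v w; rewrite -pL; apply: p_ext => c; rewrite !simpL; ring.
have gl v : linear (g^~ v).
  by move=> k u w; rewrite -pL; apply: p_ext => c; rewrite !simpL; ring.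
exists (bilin f), (bilin g); split=> x y a b; by rewrite bilinE // /f /g !pAE !pSE.
Qed.

(** The seven bialgebra conditions, in their usual order, paired with an element
    a (x) b: a coproduct becomes a product on S, and an operator applied to a
    tensor factor becomes its transpose applied to [a] or [b]. *)
Definition scalar_compat := forall x y a b,
  [/\ e (oS a b) (oA x y) = e (oS (LA x a) b) y - e (tlS a (RA y b)) x,
      e (oS a b) (oA x y) = e (oS a (RA y b)) x - e (oS (QA x a) b) y,
      e (oS a b) (oA x y) = e (oS a (LA x b)) y + e (tlS (QA y a) b) x,
      e (oS a b) (tlA x y) = e (oS a (QA x b)) y + e (oS b (QA y a)) x
    & [/\ e (oS a b) (tlA x y) = e (oS b a) (tlA x y),
          e (tlS a b) (oA x y) = e (tlS a (LA x b)) y + e (tlS (LA y a) b) x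
        & e (tlS a b) (oA x y) = e (tlS a b) (oA y x)]].

Section Perm.
Variables o tl : binop V.
Hypothesis dbl : invariant_double o tl.

Let oAe x y : o (p x 0) (p y 0) = p (oA x y) 0. Proof. by case: dbl => -[]. Qed.
Let oSe a b : o (p 0 a) (p 0 b) = p 0 (oS a b). Proof. by case: dbl => -[]. Qed.
Let tlAe x y : tl (p x 0) (p y 0) = p (tlA x y) 0.
Proof. by case: dbl => _ []. Qed.
Let tlSe a b : tl (p 0 a) (p 0 b) = p 0 (tlS a b).
Proof. by case: dbl => _ []. Qed.
Let tlC : forall u v, tl u v = tl v u. Proof. by case: dbl. Qed.
Let tl_mixedr x b : tl (p 0 b) (p x 0) = p (- RS b x) (- RA x b).
Proof. by rewrite tlC (tl_mixed dbl). Qed.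
Let pureE := (oAe, oSe, tlAe, tlSe, o_mixedl dbl, o_mixedr dbl, tl_mixed dbl,
  tl_mixedr).

Hypotheses (permA : perm_algebra oA) (permS : perm_algebra oS).
Hypothesis tlAC : forall x y, tlA x y = tlA y x.
Hypothesis tlSC : forall a b, tlS a b = tlS b a.
Hypothesis otlA : forall x y z, tlA (oA x y) z = oA x (tlA y z).
Hypothesis otlS : forall a b c, tlS (oS a b) c = oS a (tlS b c).
Hypothesis ottlA : forall x y z, oA x (tlA y z) = - tlA x (tlA y z).
Hypothesis ottlS : forall a b c, oS a (tlS b c) = - tlS a (tlS b c).

Let formE := perm_via_form Bsym Bnd tlC
   (let: And4 _ _ _ h := dbl in h).

(** The seven conditions are the identities of [perm_via_form] with two arguments
    in A and two in S; the second and the third come out only as differences with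
    the first. *)
Lemma perm_scalar : perm_algebra o -> scalar_compat.
Proof.
move/formE => Q x y a b.
have [Q1 _] := Q (p x 0) (p 0 a) (p 0 b) (p y 0).
have [Q3 Q2] := Q (p x 0) (p 0 a) (p y 0) (p 0 b).
have [Q4 Q5] := Q (p 0 a) (p 0 b) (p x 0) (p y 0).
have [Q6 Q7] := Q (p x 0) (p y 0) (p 0 a) (p 0 b).
move: Q1 Q2 Q3 Q4 Q5 Q6 Q7; rewrite !pureE !BE !pairingE => Q1 Q2 Q3 Q4 Q5 Q6 Q7.
split.
- by rewrite Q1 [tlS _ a]tlSC; ring.
- by rewrite Q1 Q2; ring.
- by rewrite Q1 -Q3.
- by apply: oppr_inj; rewrite -Q4; ring.
split=> //.
by apply: oppr_inj; rewrite -Q6 [tlS _ a]tlSC; ring.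
Qed.

(** Of the sixteen ways to place the arguments, two give 0 = 0, the six with two
    arguments on each side are the bialgebra conditions, and the other eight are
    axioms of A or of S. *)
Lemma scalar_perm : scalar_compat -> perm_algebra o.
Proof.
move=> sc; apply/formE.
have pA x y z : oA x (oA y z) = oA (oA x y) z by case: (permA x y z).
have pS a b c : oS a (oS b c) = oS (oS a b) c by case: (permS a b c).
have swA x y z : oA (oA x y) z = oA (oA y x) z by case: (permA x y z).
have swS a b c : oS (oS a b) c = oS (oS b a) c by case: (permS a b c).
(* The first three conditions in the shape in which they occur below. *)
have K1 x y a b : e (tlS (RA y b) a) x - e (oS (LA x a) b) y = - e (oS a b) (oA x y).
  by have [-> _ _ _ _] := sc x y a b; rewrite [tlS _ a]tlSC; ring.
have K2 x y a b : - e (oS a (RA y b)) x + e (oS (QA x a) b) y = - e (oS a b) (oA x y).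
  by have [_ -> _ _ _] := sc x y a b; ring.
have K3 x y a b : e (oS a (LA x b)) y + e (tlS (QA y a) b) x = e (oS a b) (oA x y).
  by have [_ _ -> _ _] := sc x y a b.
apply: pure_ind4 => [u u' v w t|u v v' w t|u v w w' t|u v w t t'|].
1-4: by rewrite !(lfunD, add_lfunE) => -[-> ->] [-> ->]; rewrite opprD.
move=> _ _ _ _ [[x ->]|[a ->]] [[y ->]|[b ->]] [[z ->]|[c ->]] [[t ->]|[d ->]].
all: rewrite !pureE !BE !pairingE; split=> //.
- by rewrite !pA // swA.
- by rewrite swA.
- by rewrite !pA // swA.
- by rewrite swA.
- by have [_ _ _ _ [_ -> _]] := sc x y c d; rewrite [tlS _ c]tlSC; ring.
- by have [_ _ _ _ [_ _ ->]] := sc x y c d.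
- by rewrite otlA [tlA t z]tlAC.
- by rewrite ottlA [tlA _ x]tlAC eNr.
- by rewrite K3 K1 opprK.
- by rewrite K1 K2.
- by rewrite K1 opprK.
- by rewrite K1 K2.
- by rewrite otlS ottlS eNl opprK [tlS _ b]tlSC.
- by rewrite ottlS eNl [tlS _ b]tlSC.
- by rewrite otlA ottlA eNr opprK [tlA _ y]tlAC.
- by rewrite ottlA eNr [tlA _ y]tlAC.
- by rewrite K2 opprK.
- by rewrite K1 K2.
- by rewrite addrC K3 K2 opprK.
- by rewrite K1 K2.
- by rewrite otlS [tlS d c]tlSC.
- by rewrite ottlS eNl [tlS _ a]tlSC.
- by have [_ _ _ -> _] := sc z t a b; ring.
- by have [_ _ _ _ [-> _ _]] := sc z t a b.
- by rewrite !pS // swS.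
- by rewrite swS.
- by rewrite !pS // swS.
- by rewrite swS.
Qed.

End Perm.

Section Equivalence.
Hypotheses (hA : special_apreperm_algebra trA tlA).
Hypotheses (hS : special_apreperm_algebra trS tlS).

Lemma quadratic_double tr tl :
  quadratic_special_apreperm_algebra tr tl B ->
  glues tr trA trS -> glues tl tlA tlS -> double_formula tr tl.
Proof.
move=> [[_ tlC] _ _ inv] [r1 r2] [l1 l2]; apply: invariant_formula; split=> //.
by split=> *; rewrite !add_lfunE ?r1 ?l1 ?r2 ?l2 -pD addr0 -?oAE -?oSE !add_lfunE.
Qed.

Lemma double_permP tr tl :
  double_formula tr tl -> perm_algebra (tr + tl) <-> scalar_compat.
Proof.
have := (special_aprepermP trA tlA).1 hA; rewrite oAE => -[permA tlAC otlA ottlA].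
have := (special_aprepermP trS tlS).1 hS; rewrite oSE => -[permS tlSC otlS ottlS].
move=> /(formula_invariant tlAC tlSC) dbl.
by split; [exact: (perm_scalar dbl) | exact: (scalar_perm dbl)].
Qed.

Lemma compat_double : scalar_compat -> exists tr tl,
  [/\ quadratic_perm_algebra (tr + tl) B, induced_apreperm (tr + tl) B tr tl,
      glues (tr + tl) oA oS, glues tr trA trS & glues tl tlA tlS].
Proof.
have [_ tlAC] := hA; have [_ tlSC] := hS.
have [tr [tl F]] := double_formula_exists => sc.
have [glo gll tlC inv] := formula_invariant tlAC tlSC F.
exists tr, tl; split=> //.
- split=> //; first by apply/(double_permP F).
  exact: (invariant_left Bsym tlC inv).
- by split=> // x y; rewrite !add_lfunE addrK.
have trE u v : tr u v = (tr + tl) u v - tl u v by rewrite !add_lfunE addrK.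
split=> *; rewrite trE ?glo.1 ?gll.1 ?glo.2 ?gll.2 p_sub -?oAE -?oSE !add_lfunE.
  by rewrite addrK subrr.
by rewrite addrK subrr.
Qed.

End Equivalence.

End Double.

(** * Tensors tested by pairing *)

Section TensorPairing.
Variable K : fieldType.
Implicit Types U V W : vectType K.

(** Puts both sides of an identity in the form of a linear map applied to [t], so
    that the map can be tested on pure tensors. *)
Lemma hom_comp_tens U V (X Y : vectType K) (F : 'Hom(tens U V, X)) (G : 'Hom(X, Y)) t :
  G (F t) = (G \o F)%VF t.
Proof. by rewrite comp_lfunE. Qed.

Lemma tpair_tmap U V U' V' (f : 'Hom(U, U')) (g : 'Hom(V, V')) (a : dual U') (b : dual V') t :
  tpair a b (tmap f g t) = tpair (a \o f)%VF (b \o g)%VF t.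
Proof.
rewrite hom_comp_tens; congr (fun_of_lfun _ t); apply: tens_ext => u v.
by rewrite comp_lfunE tmapE !tpairE !comp_lfunE.
Qed.

Lemma tpair_tflip U V (a : dual U) (b : dual V) t :
  tpair a b (tflip t) = tpair b a t.
Proof.
rewrite hom_comp_tens; congr (fun_of_lfun _ t); apply: tens_ext => u v.
by rewrite comp_lfunE tflipE !tpairE mulrC.
Qed.

Lemma tpair_tassoc U V W (a : dual U) (b : dual V) (c : dual W) t :
  tpair a (tpair b c) (tassoc t) = tpair (tpair a b) c t.
Proof.
rewrite hom_comp_tens; congr (fun_of_lfun _ t); apply: tens_ext => s w.
rewrite comp_lfunE.
pose F : 'Hom(tens U V, K^o) := linfun (fun s => tpair a (tpair b c) (tassoc (tpure s w))).
have FE s' : F s' = tpair a (tpair b c) (tassoc (tpure s' w)).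
  by rewrite /F linfunE // => k x y; rewrite tpure_linearl !linearP.
pose G : 'Hom(tens U V, K^o) := linfun (fun s => tpair (tpair a b) c (tpure s w)).
have GE s' : G s' = tpair (tpair a b) c (tpure s' w).
  by rewrite /G linfunE // => k x y; rewrite tpure_linearl !linearP.
rewrite -FE -GE; congr (fun_of_lfun _ s); apply: tens_ext => u v.
by rewrite FE GE tassocE !tpairE mulrA.
Qed.

Lemma tpair_basis U V (t : tens U V) i j :
  tpair (bdual i) (bdual j) t = (t : 'M[K]_(_, _)) i j.
Proof.
rewrite /tpair tliftEsum (bigD1 i) //= (bigD1 j) //= !bdual_bvec !eqxx.
rewrite big1 => [|l /negPf lj]; last by rewrite !bdual_bvec [j == l]eq_sym lj mulr0 scaler0.
rewrite big1 => [|k /negPf ki]; last first.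
  by rewrite big1 // => l _; rewrite !bdual_bvec [i == k]eq_sym ki mul0r scaler0.
by rewrite !addr0 mulr1 /GRing.scale /= mulr1.
Qed.

Lemma tpair_sep U V (t s : tens U V) :
  (forall a b, tpair a b t = tpair a b s) -> t = s.
Proof. by move=> ts; apply/matrixP=> i j; rewrite -!tpair_basis ts. Qed.

Definition contract U V (a : dual U) : 'Hom(tens U V, V) :=
  tlift (fun u v => a u *: v).

Lemma tpair_contract U V (a : dual U) (b : dual V) t :
  tpair a b t = b (contract V a t).
Proof.
rewrite hom_comp_tens; congr (fun_of_lfun _ t); apply: tens_ext => u v.
rewrite comp_lfunE tpairE tliftE ?linearZ // => [x|y] k c d.
  by rewrite scalerDr !scalerA mulrC.
by rewrite linearP scalerDl scalerA.
Qed.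

(** Functionals on [tens V W] need not be of the form [tpair b c]; contracting
    the first factor reduces the claim to [tens V W], where those separate. *)
Lemma tpair3_sep U V W (t s : tens U (tens V W)) :
  (forall a b c, tpair a (tpair b c) t = tpair a (tpair b c) s) -> t = s.
Proof.
move=> ts; apply: tpair_sep => a F; rewrite !tpair_contract; congr (F _).
by apply: tpair_sep => b c; rewrite -!tpair_contract.
Qed.

End TensorPairing.

Section Codual.
Variables (K : fieldType) (A : vectType K).

(** The dual as a bundled vector space.  Typing every element and operation on
    the dual over this one structure keeps conversion problems syntactic. *)
Definition dualV : vectType K := dual A.
Definition evd (b : dualV) (x : A) : K^o := (b : dual A) x.
Definition pull (m : binop A) (x : A) (b : dualV) : dualV :=
  dualrep m x (b : dual A).

Lemma evd_pull (m : binop A) x b y : evd (pull m x b) y = evd b (m x y).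
Proof. exact: dualrepE. Qed.

Lemma comp_pull (m : binop A) x (b : dualV) : ((b : dual A) \o m x)%VF = pull m x b.
Proof. by apply/lfunP=> y; rewrite comp_lfunE [RHS]evd_pull. Qed.

Definition comul (m : binop dualV) : 'Hom(A, tens A A) := codual m.

Lemma tpair_comul (m : binop dualV) (a b : dualV) (x : A) :
  tpair a b (comul m x) = evd (m a b) x.
Proof. by rewrite /evd codualP. Qed.

Lemma tpair_comul_l (o : binop A) (m : binop dualV) (a b : dualV) (x y : A) :
  tpair a b (tmap (o y) \1%VF (comul m x)) = evd (m (pull o y a) b) x.
Proof. by rewrite tpair_tmap comp_lfun1r comp_pull tpair_comul. Qed.

Lemma tpair_comul_r (o : binop A) (m : binop dualV) (a b : dualV) (x y : A) :
  tpair a b (tmap \1%VF (o y) (comul m x)) = evd (m a (pull o y b)) x.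
Proof. by rewrite tpair_tmap comp_lfun1r comp_pull tpair_comul. Qed.

Lemma comulD (m m' : binop dualV) : comul m + comul m' = comul (m + m').
Proof.
apply/lfunP=> x; apply: tpair_sep => a b.
by rewrite add_lfunE lfunD !tpair_comul /evd !add_lfunE.
Qed.

Lemma tpair_comp_comul (m : binop dualV) (a b : dualV) :
  (tpair a b \o comul m)%VF = m a b.
Proof. by apply/lfunP=> x; rewrite comp_lfunE tpair_comul. Qed.

(** Paired with a (x) b (x) c, the coalgebra axioms are the identities of
    [special_aprepermP] for the algebra on the dual. *)
Lemma comul_coalgebra (tr tl : binop dualV) :
  special_apreperm_algebra tr tl ->
  special_apreperm_coalgebra (comul tr) (comul tl).
Proof.
move=> /special_aprepermP; rewrite /special_apreperm_coalgebra comulD.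
move: (tr + tl) => o [oP tlC otl ottl] x.
have pairE := (tpair_tassoc, tpair_tmap, tpair_tflip, tpair_comp_comul,
  comp_lfun1r).
rewrite comulD; split.
- apply: tpair3_sep => a b c; rewrite !pairE !tpair_comul; by have [-> _] := oP a b c.
- apply: tpair3_sep => a b c; rewrite !pairE !tpair_comul.
  have -> : (tpair a b \o tflip)%VF = tpair b a.
    by apply/lfunP=> t; rewrite comp_lfunE tpair_tflip.
  by rewrite tpair_comp_comul; have [-> ->] := oP a b c.
- by apply: tpair_sep => a b; rewrite !pairE !tpair_comul tlC.
- by apply: tpair3_sep => a b c; rewrite !pairE !tpair_comul otl.
apply: tpair3_sep => a b c; rewrite lfun0 !pairE tpair_comul.
by rewrite !add_lfunE ottl addNr /evd zero_lfunE.
Qed.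

Lemma tpairD (t s : tens A A) (a b : dual A) :
  tpair a b (t + s) = tpair a b t + tpair a b s.
Proof. exact: lfunD. Qed.

Lemma tpairB (t s : tens A A) (a b : dual A) :
  tpair a b (t - s) = tpair a b t - tpair a b s.
Proof. exact: linearB. Qed.

Lemma tens_eqP (t s : tens A A) :
  t = s <-> forall a b : dual A, tpair a b t = tpair a b s.
Proof. by split=> [->|/tpair_sep]. Qed.

(** Each tensor identity is tested against all a (x) b, which separate tensors;
    the coalgebra part holds by [comul_coalgebra]. *)
Lemma bialgebra_compatP (tr tl : binop A) (trS tlS : binop dualV) :
  special_apreperm_algebra tr tl -> special_apreperm_algebra trS tlS ->
  special_apreperm_bialgebra tr tl (comul trS) (comul tlS) <->
  scalar_compat evd (tr + tl) tl (trS + tlS) tlS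
    (pull (tr + tl)) (pull (Rop (tr + tl))) (pull tl).
Proof.
move=> hA hS; have := comul_coalgebra hS.
rewrite /special_apreperm_bialgebra comulD.
move: hA; move: (special_apreperm_algebra _ _) (special_apreperm_coalgebra _ _) => P1 P2 h1 h2.
clear hS.
move: (trS + tlS) (tr + tl) => oS o {tr trS}.
have pairE := (tpair_comul, tpair_comul_l, tpair_comul_r).
split=> [[_ _ h] x y a b | h].
  have [] := h x y.
  move=> /tens_eqP/(_ a b). rewrite tpairB !pairE => e1.
  move=> /tens_eqP/(_ a b). rewrite tpairB !pairE => e2.
  move=> /tens_eqP/(_ a b). rewrite tpairD !pairE => e3.
  move=> /tens_eqP/(_ a b). rewrite tpairD tpair_tflip !pairE => e4.
  case.
  move=> /tens_eqP/(_ a b). rewrite tpair_tflip !pairE => e5.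
  move=> /tens_eqP/(_ a b). rewrite tpairD !pairE => e6.
  move=> /tens_eqP/(_ a b). rewrite !pairE => e7.
  by [].
split=> // x y.
have h' a b := h x y a b.
split; last split.
- apply/tens_eqP => a b; rewrite tpairB !pairE; by case: (h' a b).
- apply/tens_eqP => a b; rewrite tpairB !pairE; by case: (h' a b).
- apply/tens_eqP => a b; rewrite tpairD !pairE; by case: (h' a b).
- apply/tens_eqP => a b; rewrite tpairD tpair_tflip !pairE; by case: (h' a b).
- apply/tens_eqP => a b; rewrite tpair_tflip !pairE; by case: (h' a b) => _ _ _ _ [].
- apply/tens_eqP => a b; rewrite tpairD !pairE; by case: (h' a b)=> _ _ _ _ [].
- apply/tens_eqP => a b; rewrite !pairE; by case: (h' a b)=> _ _ _ _ [].
Qed.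

End Codual.

(** * The double of an algebra and its dual *)

Section Standard.
Variables (K : fieldType) (A : vectType K).
Notation S := (dualV A).

Definition doubleV : vectType K := (A * dual A)%type.
Definition formD : bilform doubleV := formd A.
Definition mkD (x : A) (a : S) : doubleV := (x, a).
Definition fstD (u : doubleV) : A := u.1.
Definition sndD (u : doubleV) : S := u.2.

Definition pullLR (m : binop A) (x : A) (b : S) : S :=
  (dualrep (Lop m) + dualrep (Rop m)) x b.
Definition actL (m : binop S) : 'Hom(S, 'End(A)) := predualrep (Lop m).
Definition actR (m : binop S) : 'Hom(S, 'End(A)) := predualrep (Rop m).

Lemma evd_linl k (a b : S) x : evd (k *: a + b) x = k * evd a x + evd b x.
Proof. by rewrite /evd add_lfunE scale_lfunE. Qed.
Lemma evd_linr k (a : S) x y : evd a (k *: x + y) = k * evd a x + evd a y.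
Proof. by rewrite /evd lfunL. Qed.
Lemma mkD_lin k x y (a b : S) :
  mkD (k *: x + y) (k *: a + b) = k *: mkD x a + mkD y b.
Proof. by []. Qed.
Lemma mkDK u : mkD (fstD u) (sndD u) = u.
Proof. by case: u. Qed.
Lemma mkD_fst x (a : S) : fstD (mkD x a) = x. Proof. by []. Qed.
Lemma mkD_snd x (a : S) : sndD (mkD x a) = a. Proof. by []. Qed.
Lemma formD_mkD x y (a b : S) : formD (mkD x a) (mkD y b) = evd b x + evd a y.
Proof. exact: formdE. Qed.
Lemma formD_sym : symmetric_form formD. Proof. exact: formd_sym. Qed.
Lemma formD_nondegenerate : nondegenerate formD.
Proof. exact: formd_nondegenerate. Qed.

Lemma evd_pullR (m : binop A) x b y : evd (pull (Rop m) x b) y = evd b (m y x).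
Proof. by rewrite evd_pull RopE. Qed.
Lemma evd_pullLR (m : binop A) x b y :
  evd (pullLR m x b) y = evd b (m x y) + evd b (m y x).
Proof.
rewrite /evd /pullLR (add_lfunE (dualrep (Lop m))) (add_lfunE (dualrep (Lop m) x)).
by rewrite add_lfunE !dualrepE RopE.
Qed.
Lemma evd_actL (m : binop S) a x b : evd b (actL m a x) = evd (m a b) x.
Proof. exact: predualrepE. Qed.
Lemma evd_actR (m : binop S) a x b : evd b (actR m a x) = evd (m b a) x.
Proof. by rewrite /evd -(RopE m); exact: predualrepE. Qed.
Lemma evd_actLR (m : binop S) a x b :
  evd b ((actL m + actR m) a x) = evd (m a b) x + evd (m b a) x.
Proof. by rewrite -evd_actL -evd_actR !add_lfunE /evd lfunD. Qed.

Variables (trA tlA : binop A) (trS tlS : binop S).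
Notation oA := (trA + tlA).
Notation oS := (trS + tlS).
Hypothesis hA : special_apreperm_algebra trA tlA.
Hypothesis hS : special_apreperm_algebra trS tlS.

Lemma evd_pullC x b y : evd (pull tlA x b) y = evd b (tlA y x).
Proof. by rewrite evd_pull hA.2. Qed.

Definition std_formula := double_formula mkD trA tlA trS tlS
  (pull (Rop oA)) (pullLR oA) (pull (Rop trA))
  (fun a => (actL oS + actR oS) a) (fun a => actR oS a) (fun a => actR trS a).

Lemma std_quadratic_formula (tr tl : binop doubleV) :
  quadratic_special_apreperm_algebra tr tl formD ->
  glues mkD tr trA trS -> glues mkD tl tlA tlS -> std_formula tr tl.
Proof.
exact: (quadratic_double (prA := fstD) (prS := sndD) evd_linl evd_linr mkD_lin mkDK
  formD_mkD formD_sym formD_nondegenerate (erefl oA) (erefl oS)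
  (evd_pull oA) (evd_pullR oA) evd_pullC (evd_pullLR oA) (evd_pullR trA)
  (evd_actLR oS) (evd_actR oS) (evd_actR trS)).
Qed.

Lemma std_permP (tr tl : binop doubleV) : std_formula tr tl ->
  perm_algebra (tr + tl) <->
  special_apreperm_bialgebra trA tlA (comul trS) (comul tlS).
Proof.
move=> F; apply: iff_trans (iff_sym (bialgebra_compatP hA hS)).
exact: (double_permP (prA := fstD) (prS := sndD) evd_linl evd_linr mkD_lin mkDK
  formD_mkD formD_sym formD_nondegenerate (erefl oA) (erefl oS)
  (evd_pull oA) (evd_pullR oA) evd_pullC (evd_pullLR oA) (evd_pullR trA)
  (evd_actLR oS) (evd_actR oS) (evd_actR trS) hA hS F).
Qed.

Lemma std_double :
  special_apreperm_bialgebra trA tlA (comul trS) (comul tlS) ->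
  exists tr tl : binop doubleV,
  [/\ quadratic_perm_algebra (tr + tl) formD,
      induced_apreperm (tr + tl) formD tr tl, glues mkD (tr + tl) oA oS,
      glues mkD tr trA trS & glues mkD tl tlA tlS].
Proof.
move/(bialgebra_compatP hA hS).
exact: (compat_double (prA := fstD) (prS := sndD) evd_linl evd_linr mkD_lin mkDK
  mkD_fst mkD_snd
  formD_mkD formD_sym formD_nondegenerate (erefl oA) (erefl oS)
  (evd_pull oA) (evd_pullR oA) evd_pullC (evd_pullLR oA) (evd_pullR trA)
  (evd_actLR oS) (evd_actR oS) (evd_actR trS) hA hS).
Qed.

(** Stated over [dualV A] and [doubleV], where the lemmas on an abstract double
    apply without a change of vector space structure. *)
Lemma std_tfae :
  [<-> exists od trd tld : binop doubleV,
         [/\ [/\ perm_algebra oA, perm_algebra oS, quadratic_perm_algebra od formD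
               & glues mkD od oA oS],
             induced_apreperm od formD trd tld,
             glues mkD trd trA trS & glues mkD tld tlA tlS];
       exists trd tld : binop doubleV,
         [/\ special_apreperm_algebra trA tlA, special_apreperm_algebra trS tlS,
             quadratic_special_apreperm_algebra trd tld formD,
             glues mkD trd trA trS & glues mkD tld tlA tlS];
       exists trd tld : binop doubleV,
         [/\ special_apreperm_algebra trd tld,
             forall (x y : A) (a b : S), trd (mkD x a) (mkD y b) =
               mkD (trA x y + (actL oS + actR oS) a y + actR trS b x)
                   (trS a b + pullLR oA x b + pull (Rop trA) y a)
           & forall (x y : A) (a b : S), tld (mkD x a) (mkD y b) =
               mkD (tlA x y - actR oS a y - actR oS b x)
                   (tlS a b - pull (Rop oA) x b - pull (Rop oA) y a)];
       special_apreperm_bialgebra trA tlA (comul trS) (comul tlS)].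
Proof.
tfae.
- move=> [od [trd [tld [[_ _ hq _] hi er el]]]]; exists trd, tld; split=> //.
  exact: induced_quadratic_special hq hi.
- move=> [trd [tld [_ _ hq er el]]]; exists trd, tld.
  have [trE tlE] := std_quadratic_formula hq er el.
  by case: hq.
- move=> [trd [tld [[[P _] _] trE tlE]]].
  exact: (std_permP (conj trE tlE)).1 P.
move=> /std_double [trd [tld [hq hi eo er el]]].
have [[permA _] _] := hA; have [[permS _] _] := hS.
by exists (trd + tld), trd, tld.
Qed.

End Standard.

Theorem corollary4p12 (K : closedFieldType) (hK : [pchar K] =i pred0)
    (A : vectType K)
    (trA tlA : binop A) (trS tlS : binop (dual A))
    (hA : special_apreperm_algebra trA tlA)
    (hS : special_apreperm_algebra trS tlS) :
  let oA := trA + tlA in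
  let oS := trS + tlS in
  [<-> exists (od trd tld : binop (A * dual A)%type),
         [/\ manin_triple_perm od oA oS,
             induced_apreperm od (formd A) trd tld,
             extends trd trA trS & extends tld tlA tlS];
       exists (trd tld : binop (A * dual A)%type),
         manin_triple_special_apreperm trd tld trA tlA trS tlS;
       exists (trd tld : binop (A * dual A)%type),
         [/\ special_apreperm_algebra trd tld,
             forall (x y : A) (a b : dual A),
               trd (x, a) (y, b) =
               (trA x y
                + (predualrep (Lop oS) + predualrep (Rop oS)) a y
                + predualrep (Rop trS) b x,
                trS a b
                + (dualrep (Lop oA) + dualrep (Rop oA)) x b
                + dualrep (Rop trA) y a)
           & forall (x y : A) (a b : dual A),
               tld (x, a) (y, b) =
               (tlA x y
                - predualrep (Rop oS) a y - predualrep (Rop oS) b x,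
                tlS a b
                - dualrep (Rop oA) x b - dualrep (Rop oA) y a)];
       special_apreperm_bialgebra trA tlA (codual trS) (codual tlS)].
Proof.
move=> oA oS.
have h := std_tfae hA hS.
(* The two statements differ by unfolding definitions and by the vector space *)
(* structures inferred for the dual and the double; the kernel decides this    *)
(* conversion faster than unification.                                         *)
exact_no_check h.
Qed.
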